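(* (1) Let $\mathcal{L}_1=(L_1,\wedge_1,\vee_1,\odot_1,\rightarrow_1,0_1,1_1)$ and $\mathcal{L}_2=(L_2,\wedge_2,\vee_2,\odot_2,\rightarrow_2,0_2,1_2)$ be two BL-algebras with $1_1=0_2$ and $(L_1\setminus\{1_1\})\cap(L_2\setminus\{0_2\})=\emptyset$. Their ordinal sum $\mathcal{L}_1\boxplus\mathcal{L}_2=(L_1\cup L_2,\wedge,\vee,\odot,\rightarrow,0=0_1,1=1_2)$ is a residuated lattice which is not a BL-algebra if $L_1$ is not a chain. (2) The ordinal sum of a BL-chain $L_1$ and a BL-algebra $L_2$ is a BL-algebra $L_1\boxplus L_2$ with $\max\mathcal{D}(L_1\boxplus L_2)\neq 0$ which is not an MV-algebra. (3) The ordinal sum construction (of finitely many BL-chains followed by a BL-algebra) provides a way to generate finite BL-comets which are not MV-algebras.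
   Context: A (commutative) residuated lattice is an algebra $(L,\wedge,\vee,\odot,\rightarrow,0,1)$ such that $(L,\wedge,\vee,0,1)$ is a bounded lattice with order $\leq$, $(L,\odot,1)$ is a commutative ordered monoid, and $z\leq x\rightarrow y$ iff $x\odot z\leq y$ for all $x,y,z\in L$. Put $x^{\ast}=x\rightarrow 0$. A BL-algebra is a residuated lattice satisfying $(x\rightarrow y)\vee(y\rightarrow x)=1$ and $x\odot(x\rightarrow y)=x\wedge y$ for all $x,y$; a BL-chain is a totally ordered BL-algebra. A BL-algebra is an MV-algebra when $x^{\ast\ast}=x$ for all $x$. Ordinal sum: $\mathcal{L}_1\boxplus\mathcal{L}_2$ has underlying set $L_1\cup L_2$ (with $1_1=0_2$ identified), $0=0_1$, $1=1_2$. The order is: $x\leq y$ iff $x,y\in L_i$ and $x\leq_i y$ for some $i$, or $x\in L_1$ and $y\in L_2$; meets and joins of two elements of the same $L_i$ are computed in $L_i$, and for $x\in L_1$, $y\in L_2$, $x\wedge y=x$, $x\vee y=y$. The implication is $x\rightarrow y=1$ if $x\leq y$; $x\rightarrow y=x\rightarrow_i y$ if $x\nleq y$ and $x,y\in L_i$; $x\rightarrow y=y$ if $x\nleq y$, $x\in L_2$, $y\in L_1\setminus\{1_1\}$. The product is $x\odot y=x\odot_i y$ if $x,y\in L_i$, and $x\odot y=y\odot x=x$ if $x\in L_1\setminus\{1_1\}$, $y\in L_2$. The ordinal sum $C_1\boxplus\dots\boxplus C_t$ of BL-chains $C_1,\dots,C_{t-1}$ and a BL-algebra $C_t$, with $1_i=0_{i+1}$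 and $(C_i\setminus\{1_i\})\cap(C_{i+1}\setminus\{0_{i+1}\})=\emptyset$, is defined by the same rules, with elements of $C_i$ below those of $C_j$ for $i<j$. For a finite BL-algebra $L$, let $\mathcal{I}(L)=\{x\in L: x\odot x=x\}$, and for $x\in\mathcal{I}(L)$ let $\mathcal{C}(x)$ be the set of $y\in\mathcal{I}(L)$ comparable with $x$. Let $\mathcal{D}(L)$ be the set of $x\in\mathcal{I}(L)$ such that $\mathcal{C}(x)=\mathcal{I}(L)$ and $\{y\in\mathcal{I}(L): y\leq x\}$ is a chain; the same notation is used for $L_1\boxplus L_2$ in (2). A finite BL-algebra $L$ is called a BL-comet if $\max\mathcal{D}(L)\neq 0$.
   Formalization: One-element summands are excluded where claims fail (two nontrivial components in (3)); components are disjoint for all i<j; for infinite sums in (2), where max D may not exist, D has a nonzero element and any maximum is nonzero; existence of max D is claimed for finite sums. *)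

(* Defs.v *)
From mathcomp Require Import all_boot.
From mathcomp Require Import all_classical.

Set Implicit Arguments.
Unset Strict Implicit.
Unset Printing Implicit Defensive.

Local Open Scope classical_set_scope.

(* Algebras are carried by subsets of a common ambient type U, so that gluing
   two of them along 1_1 = 0_2 is literally the union of their carriers.  The
   operations are total on U; only their values on the carrier matter. *)
Record algebra (U : Type) := Algebra {
  carrier : set U;
  le : U -> U -> Prop;
  meet : U -> U -> U;
  join : U -> U -> U;
  mul : U -> U -> U;
  imp : U -> U -> U;
  zero_of : U;
  one_of : U }.

Section Classes.
Variables (U : Type) (L : algebra U).

Local Notation A := (carrier L).

Definition closed_under (op : U -> U -> U) : Prop :=
  forall x y, A x -> A y -> A (op x y).

Definition is_partial_order : Prop :=
  [/\ forall x, A x -> le L x x,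
      forall x y, A x -> A y -> le L x y -> le L y x -> x = y
    & forall x y z, A x -> A y -> A z -> le L x y -> le L y z -> le L x z].

Definition is_bounded_lattice : Prop :=
  [/\ is_partial_order,
      [/\ closed_under (meet L),
          forall x y, A x -> A y -> le L (meet L x y) x /\ le L (meet L x y) y
        & forall x y z, A x -> A y -> A z ->
            le L z x -> le L z y -> le L z (meet L x y)],
      [/\ closed_under (join L),
          forall x y, A x -> A y -> le L x (join L x y) /\ le L y (join L x y)
        & forall x y z, A x -> A y -> A z ->
            le L x z -> le L y z -> le L (join L x y) z],
      A (zero_of L) /\ (forall x, A x -> le L (zero_of L) x)
    & A (one_of L) /\ (forall x, A x -> le L x (one_of L))].

Definition is_comm_ordered_monoid : Prop :=
  [/\ closed_under (mul L),
      forall x y z, A x -> A y -> A z ->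
        mul L x (mul L y z) = mul L (mul L x y) z,
      forall x y, A x -> A y -> mul L x y = mul L y x,
      forall x, A x -> mul L x (one_of L) = x
    & forall x y z, A x -> A y -> A z ->
        le L x y -> le L (mul L x z) (mul L y z)].

Definition is_residuated_lattice : Prop :=
  [/\ is_bounded_lattice,
      is_comm_ordered_monoid,
      closed_under (imp L)
    & forall x y z, A x -> A y -> A z ->
        (le L z (imp L x y) <-> le L (mul L x z) y)].

Definition is_BL_algebra : Prop :=
  [/\ is_residuated_lattice,
      forall x y, A x -> A y -> join L (imp L x y) (imp L y x) = one_of L
    & forall x y, A x -> A y -> mul L x (imp L x y) = meet L x y].

Definition is_chain : Prop := total_on A (le L).

Definition is_BL_chain : Prop := is_BL_algebra /\ is_chain.

Definition neg (x : U) : U := imp L x (zero_of L).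

Definition is_MV_algebra : Prop :=
  is_BL_algebra /\ forall x, A x -> neg (neg x) = x.

Definition nontrivial : Prop := zero_of L <> one_of L.

Definition idempotents : set U := [set x | A x /\ mul L x x = x].

Definition comparables (x : U) : set U :=
  [set y | idempotents y /\ (le L x y \/ le L y x)].

(* The set D(L), whose maximum, when nonzero, makes a finite L a BL-comet. *)
Definition nodes : set U :=
  [set x | [/\ idempotents x,
               comparables x = idempotents
             & total_on [set y | idempotents y /\ le L y x] (le L)]].

Definition is_max (B : set U) (m : U) : Prop :=
  B m /\ forall y, B y -> le L y m.

Definition is_BL_comet : Prop :=
  [/\ is_BL_algebra,
      finite_set A
    & exists m, is_max nodes m /\ m <> zero_of L].

End Classes.

Section OrdinalSum.
Variable U : Type.

Definition glueable (L1 L2 : algebra U) : Prop :=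
  one_of L1 = zero_of L2 /\
  (carrier L1 `\ one_of L1) `&` (carrier L2 `\ zero_of L2) = set0.

Section Binary.
Variables L1 L2 : algebra U.

Local Notation in1 x y := ((x \in carrier L1) && (y \in carrier L1)).
Local Notation in2 x y := ((x \in carrier L2) && (y \in carrier L2)).

Definition osum_le (x y : U) : Prop :=
  [\/ [/\ carrier L1 x, carrier L1 y & le L1 x y],
      [/\ carrier L2 x, carrier L2 y & le L2 x y]
    | carrier L1 x /\ carrier L2 y].

(* Once in1 and in2 both fail, x and y lie in different summands, and
   x \in carrier L1 tells which is lower. *)
Definition osum : algebra U := {|
  carrier := carrier L1 `|` carrier L2;
  le := osum_le;
  meet := fun x y =>
    if in1 x y then meet L1 x y
    else if in2 x y then meet L2 x y
    else if x \in carrier L1 then x else y;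
  join := fun x y =>
    if in1 x y then join L1 x y
    else if in2 x y then join L2 x y
    else if x \in carrier L1 then y else x;
  mul := fun x y =>
    if in1 x y then mul L1 x y
    else if in2 x y then mul L2 x y
    else if x \in carrier L1 then x else y;
  imp := fun x y =>
    if `[< osum_le x y >] then one_of L2
    else if in1 x y then imp L1 x y
    else if in2 x y then imp L2 x y
    else y;
  zero_of := zero_of L1;
  one_of := one_of L2 |}.

End Binary.

Section Nary.
Variables (n : nat) (C : 'I_n.+1 -> algebra U).

(* Disjointness is required of all pairs i < j: with adjacent pairs only, two
   distant components could overlap and the sum would be ill-defined. *)
Definition glueable_family : Prop :=
  (forall i j : 'I_n.+1, j = i.+1 :> nat -> one_of (C i) = zero_of (C j)) /\
  (forall i j : 'I_n.+1, (i < j)%N ->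
     (carrier (C i) `\ one_of (C i)) `&` (carrier (C j) `\ zero_of (C j)) = set0).

Definition nsum_le (x y : U) : Prop :=
  (exists i, [/\ carrier (C i) x, carrier (C i) y & le (C i) x y]) \/
  (exists i j : 'I_n.+1, [/\ (i < j)%N, carrier (C i) x & carrier (C j) y]).

(* For a glueable family of BL-algebras, a component containing both x
   and y is unique unless x = y is a gluing point 1_i = 0_(i+1), and then the
   value of each operation does not depend on the pick. *)
Definition common (x y : U) : option 'I_n.+1 :=
  [pick i | (x \in carrier (C i)) && (y \in carrier (C i))].

Definition nsum : algebra U := {|
  carrier := \bigcup_i carrier (C i);
  le := nsum_le;
  meet := fun x y =>
    if common x y is Some i then meet (C i) x y
    else if `[< nsum_le x y >] then x else y;
  join := fun x y =>
    if common x y is Some i then join (C i) x y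
    else if `[< nsum_le x y >] then y else x;
  mul := fun x y =>
    if common x y is Some i then mul (C i) x y
    else if `[< nsum_le x y >] then x else y;
  imp := fun x y =>
    if `[< nsum_le x y >] then one_of (C ord_max)
    else if common x y is Some i then imp (C i) x y
    else y;
  zero_of := zero_of (C ord0);
  one_of := one_of (C ord_max) |}.

End Nary.
End OrdinalSum.

(* Main.v *)
From mathcomp Require Import all_boot.
From mathcomp Require Import all_classical.
Require Import Defs.

Set Implicit Arguments.
Unset Strict Implicit.
Unset Printing Implicit Defensive.

Local Open Scope classical_set_scope.

(** An ordinal sum is governed by two facts: inside a summand everything is
    computed as before (only the top changes, hence [imp x y] for [x <= y]),
    and an element [x] of the lower summand absorbs every element [y] of the
    upper one, [x * y = x /\ y = x].  The relation [is_ordinal_sum] records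
    these facts without reference to a concrete formula.  From it,
    [os_residuated] derives the laws of a residuated lattice by distributing
    the arguments over the two summands; whenever an inequality runs from the
    upper summand down to the lower one, both sides are the gluing point.
    Divisibility survives gluing, whereas prelinearity survives only if the
    lower summand is a chain: for incomparable [x, y] below, the join of
    [imp x y] and [imp y x] cannot exceed the gluing point
    ([os_BL], [osum_not_BL]).

    A gluing point [e] is idempotent and comparable with everything, and the
    elements below it form a chain.  Such a point ([is_cut]) is a node, so the
    maximum of the nodes, which exists in a finite algebra because nodes are
    pairwise comparable, lies above [e].  Moreover [neg e = 0] as soon as
    [e <> 0], so that [neg (neg e) = 1], which differs from [e] if something
    lies above [e] ([cut_node], [cut_max], [cut_not_MV]).

    The n-ary sum is reduced to the binary one by splitting off the lowest
    component ([nsum_ordinal_sum]): the remaining family again consists of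
    chains followed by a BL-algebra, and induction applies.  The care needed is
    with trivial components, through which one and the same point can belong to
    several, even distant, components ([overlap]); the meet, join and product
    of all components containing a point then agree at it ([nsum_ext]). *)

(** * Residuated lattices on a carrier *)

(** The nested conjunctions of [is_residuated_lattice], flattened so that each
    law has a name. *)
Record residuated (U : Type) (L : algebra U) : Prop := Residuated {
  le_refl : forall x, carrier L x -> le L x x;
  le_anti : forall x y, carrier L x -> carrier L y ->
    le L x y -> le L y x -> x = y;
  le_trans : forall y x z, carrier L x -> carrier L y -> carrier L z ->
    le L x y -> le L y z -> le L x z;
  meet_closed : closed_under L (meet L);
  meet_lel : forall x y, carrier L x -> carrier L y -> le L (meet L x y) x;
  meet_ler : forall x y, carrier L x -> carrier L y -> le L (meet L x y) y;
  meet_glb : forall x y z, carrier L x -> carrier L y -> carrier L z ->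
    le L z x -> le L z y -> le L z (meet L x y);
  join_closed : closed_under L (join L);
  join_gel : forall x y, carrier L x -> carrier L y -> le L x (join L x y);
  join_ger : forall x y, carrier L x -> carrier L y -> le L y (join L x y);
  join_lub : forall x y z, carrier L x -> carrier L y -> carrier L z ->
    le L x z -> le L y z -> le L (join L x y) z;
  zero_closed : carrier L (zero_of L);
  zero_le : forall x, carrier L x -> le L (zero_of L) x;
  one_closed : carrier L (one_of L);
  le_one : forall x, carrier L x -> le L x (one_of L);
  mul_closed : closed_under L (mul L);
  mulA : forall x y z, carrier L x -> carrier L y -> carrier L z ->
    mul L x (mul L y z) = mul L (mul L x y) z;
  mulC : forall x y, carrier L x -> carrier L y -> mul L x y = mul L y x;
  mulx1 : forall x, carrier L x -> mul L x (one_of L) = x;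
  mul_mono : forall x y z, carrier L x -> carrier L y -> carrier L z ->
    le L x y -> le L (mul L x z) (mul L y z);
  imp_closed : closed_under L (imp L);
  residuation : forall x y z, carrier L x -> carrier L y -> carrier L z ->
    (le L z (imp L x y) <-> le L (mul L x z) y) }.

Lemma residuatedP (U : Type) (L : algebra U) :
  is_residuated_lattice L <-> residuated L.
Proof.
split.
  case=> [[[lr la lt] [mc ml mg] [jc jl jg] [zc zl] [oc ol]]
          [uc ua um u1 uo] ic res].
  split=> // [y x z Ax Ay Az|x y Ax Ay|x y Ax Ay|x y Ax Ay|x y Ax Ay].
  - exact: lt.
  - by case: (ml x y Ax Ay).
  - by case: (ml x y Ax Ay).
  - by case: (jl x y Ax Ay).
  - by case: (jl x y Ax Ay).
case=> lr la lt mc ml1 ml2 mg jc jl1 jl2 jg zc zl oc ol uc ua um u1 uo ic res.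
split=> //; split=> //.
- by split=> // x y z Ax Ay Az; apply: lt.
- by split=> // x y Ax Ay; split; [apply: ml1 | apply: ml2].
- by split=> // x y Ax Ay; split; [apply: jl1 | apply: jl2].
Qed.

Lemma BL_residuated (U : Type) (L : algebra U) :
  is_BL_algebra L -> residuated L.
Proof. by case=> /residuatedP. Qed.

Section ResiduatedTheory.
Variables (U : Type) (L : algebra U).
Hypothesis rL : residuated L.

Local Notation A := (carrier L).
Local Notation "0" := (zero_of L).
Local Notation "1" := (one_of L).

Lemma mul1x x : A x -> mul L 1 x = x.
Proof. by move=> Ax; rewrite (mulC rL) ?(mulx1 rL) //; apply: one_closed. Qed.

Lemma mul_ler x y : A x -> A y -> le L (mul L x y) y.
Proof.
move=> Ax Ay; rewrite -[X in le L _ X]mul1x //.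
by apply: (mul_mono rL) => //; [apply: one_closed | apply: le_one].
Qed.

Lemma mulx0 x : A x -> mul L x 0 = 0.
Proof.
move=> Ax; have A0 := zero_closed rL.
have Am := mul_closed rL Ax A0.
by apply: (le_anti rL) => //; [apply: mul_ler | apply: zero_le].
Qed.

Lemma mul0x x : A x -> mul L 0 x = 0.
Proof. by move=> Ax; rewrite (mulC rL) ?mulx0 //; apply: zero_closed. Qed.

Lemma meet_l x y : A x -> A y -> le L x y -> meet L x y = x.
Proof.
move=> Ax Ay xy; have Am := meet_closed rL Ax Ay.
apply: (le_anti rL) => //; first exact: meet_lel.
by apply: (meet_glb rL) => //; apply: le_refl.
Qed.

Lemma meet_r x y : A x -> A y -> le L y x -> meet L x y = y.
Proof.
move=> Ax Ay xy; have Am := meet_closed rL Ax Ay.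
apply: (le_anti rL) => //; first exact: meet_ler.
by apply: (meet_glb rL) => //; apply: le_refl.
Qed.

Lemma join_l x y : A x -> A y -> le L y x -> join L x y = x.
Proof.
move=> Ax Ay xy; have Am := join_closed rL Ax Ay.
apply: (le_anti rL) => //; last exact: join_gel.
by apply: (join_lub rL) => //; apply: le_refl.
Qed.

Lemma join_r x y : A x -> A y -> le L x y -> join L x y = y.
Proof.
move=> Ax Ay xy; have Am := join_closed rL Ax Ay.
apply: (le_anti rL) => //; last exact: join_ger.
by apply: (join_lub rL) => //; apply: le_refl.
Qed.

Lemma imp1x y : A y -> imp L 1 y = y.
Proof.
move=> Ay; have A1 := one_closed rL; have Ai := imp_closed rL A1 Ay.
apply: (le_anti rL) => //.
  rewrite -[X in le L X _]mul1x //.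
  by apply/(residuation rL) => //; apply: le_refl.
by apply/(residuation rL) => //; rewrite mul1x //; apply: le_refl.
Qed.

Lemma imp_le x y : A x -> A y -> le L x y -> imp L x y = 1.
Proof.
move=> Ax Ay xy; have A1 := one_closed rL; have Ai := imp_closed rL Ax Ay.
apply: (le_anti rL) => //; first exact: le_one.
by apply/(residuation rL) => //; rewrite (mulx1 rL).
Qed.

Lemma prelinear_cmp x y : A x -> A y -> le L x y \/ le L y x ->
  join L (imp L x y) (imp L y x) = 1.
Proof.
move=> Ax Ay xy; have A1 := one_closed rL.
have [Axy Ayx] := (imp_closed rL Ax Ay, imp_closed rL Ay Ax).
case: xy => xy; rewrite (imp_le _ _ xy) //.
  by apply: join_l => //; apply: le_one.
by apply: join_r => //; apply: le_one.
Qed.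

End ResiduatedTheory.

(** * Cut points *)

Section CutPoints.
Variables (U : Type) (L : algebra U).
Hypothesis BL : is_BL_algebra L.
Let rL : residuated L := BL_residuated BL.

Local Notation A := (carrier L).
Local Notation "0" := (zero_of L).
Local Notation "1" := (one_of L).

(** The points at which two summands of an ordinal sum are glued, the lower of
    them being a chain, have these properties, and the conclusions about
    [nodes] and [neg] depend on nothing else. *)
Record is_cut (e : U) : Prop := IsCut {
  cut_in : A e;
  cut_idem : mul L e e = e;
  cut_cmp : forall x, A x -> le L x e \/ le L e x;
  cut_chain : total_on [set x | A x /\ le L x e] (le L) }.

Lemma cut_node e : is_cut e -> nodes L e.
Proof.
case=> Ae ee cmp chain; split=> //.
- apply/seteqP; split=> [y []//|y [Ay yy]]; split=> //.
  by case: (cmp y Ay); [right | left].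
- by move=> x y [[Ax _] xe] [[Ay _] ye]; apply: chain.
Qed.

(** Any two nodes are comparable, since a node is comparable with every
    idempotent; so finitely many of them have a maximum. *)
Lemma nodes_max : finite_set A -> nodes L !=set0 ->
  exists m, is_max L (nodes L) m.
Proof.
have nodeA x : nodes L x -> A x by case=> [[]].
have cmp x y : nodes L x -> nodes L y -> le L x y \/ le L y x.
  by move=> [_ Cx _] [iy _ _]; move: iy; rewrite -Cx => -[].
move=> /(@finite_seqP {classic U})[s sE] [x0 Nx0].
have {sE} sub x : nodes L x -> (x : {classic U}) \in s.
  by move=> /nodeA; rewrite sE.
suff [m Nm mP] : exists2 m, nodes L m &
    forall x, nodes L x -> (x : {classic U}) \in s -> le L x m.
  by exists m; split=> // y Ny; apply: mP => //; apply: sub.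
elim: s {sub} => [|a s [m Nm mP]]; first by exists x0.
have [Na|Na] := pselect (nodes L a); last first.
  exists m => // x Nx; rewrite inE => /orP[/eqP xa|]; last exact: mP.
  by case: Na; rewrite -xa.
have [am|ma] := cmp a m Na Nm.
  by exists m => // x Nx; rewrite inE => /orP[/eqP->//|]; apply: mP.
exists a => // x Nx; rewrite inE => /orP[/eqP->|xs].
  by apply: (le_refl rL); apply: nodeA.
by apply: (le_trans rL) ma; [exact: nodeA.. | apply: mP].
Qed.

Lemma cut_max_neq0 e m : is_cut e -> e <> 0 -> is_max L (nodes L) m -> m <> 0.
Proof.
move=> ce e0 [_ mP] m0; apply: e0; apply: (le_anti rL).
- exact: cut_in.
- exact: zero_closed.
- by rewrite -m0; apply: mP; apply: cut_node.
- by apply: (zero_le rL); apply: cut_in.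
Qed.

Lemma cut_max e : is_cut e -> e <> 0 -> finite_set A ->
  exists m, is_max L (nodes L) m /\ m <> 0.
Proof.
move=> ce e0 finA; have [|m mP] := nodes_max finA.
  by exists e; apply: cut_node.
by exists m; split=> //; exact: (cut_max_neq0 ce e0 mP).
Qed.

(** The complement [neg e] of a nonzero cut point is [0]: it cannot lie above
    [e], because then [e = e * e] would lie below [e * neg e = 0]; and below
    [e], the product with the idempotent [e] is the meet.  Hence
    [neg (neg e) = 1]. *)
Lemma cut_not_MV e : is_cut e -> e <> 0 -> e <> 1 -> ~ is_MV_algebra L.
Proof.
case=> Ae ee cmp _ e0 e1 [_ MV].
have A0 := zero_closed rL; have A1 := one_closed rL.
have An : A (neg L e) by apply: (imp_closed rL).
have Am := mul_closed rL Ae An.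
have en0 : mul L e (neg L e) = 0.
  apply: (le_anti rL) => //; last exact: zero_le.
  by apply/(residuation rL) => //; apply: le_refl.
have [ne|en] := cmp _ An.
  have n0 : neg L e = 0.
    have [_ _ dv] := BL.
    have Ai := imp_closed rL Ae An.
    have nE : mul L e (imp L e (neg L e)) = neg L e.
      by rewrite dv // (meet_r rL).
    by rewrite -en0 -[in RHS]nE (mulA rL) // ee nE.
  apply: e1; rewrite -(MV e Ae) n0 /neg (imp_le rL) //.
  exact: zero_le.
apply: e0; apply: (le_anti rL) => //; last exact: zero_le.
rewrite -[X in le L _ X]en0 -{1}ee (mulC rL Ae An).
exact: (mul_mono rL).
Qed.

End CutPoints.

(** * Ordinal sums of two algebras *)

Section OrdinalSums.
Variables (U : Type) (L L1 L2 : algebra U).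

(** The clause on [imp] omits the case [le L x y], because there the value in
    [L] is the top element of [L] and not that of the summand [M]. *)
Definition extends (M : algebra U) : Prop :=
  forall x y, carrier M x -> carrier M y ->
  [/\ le L x y <-> le M x y,
      meet L x y = meet M x y,
      join L x y = join M x y,
      mul L x y = mul M x y
    & ~ le L x y -> imp L x y = imp M x y].

Section ExtendsTheory.
Variable M : algebra U.
Hypothesis ext : extends M.

Lemma ext_le x y : carrier M x -> carrier M y -> le L x y <-> le M x y.
Proof. by move=> Mx My; case: (ext Mx My). Qed.

Lemma ext_meet x y : carrier M x -> carrier M y -> meet L x y = meet M x y.
Proof. by move=> Mx My; case: (ext Mx My). Qed.

Lemma ext_join x y : carrier M x -> carrier M y -> join L x y = join M x y.
Proof. by move=> Mx My; case: (ext Mx My). Qed.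

Lemma ext_mul x y : carrier M x -> carrier M y -> mul L x y = mul M x y.
Proof. by move=> Mx My; case: (ext Mx My). Qed.

Lemma ext_imp x y : carrier M x -> carrier M y -> ~ le L x y ->
  imp L x y = imp M x y.
Proof. by move=> Mx My; case: (ext Mx My). Qed.

End ExtendsTheory.

(** The ordinal sum up to the values of the operations outside the carrier.
    Iterated and n-ary sums differ by those values, so that they are compared
    through this relation rather than by equality.  The clause [os_imp] excludes
    the gluing point because there [imp L y x] is computed in [L2] and is in
    general not [x]. *)
Record is_ordinal_sum : Prop := IsOrdinalSum {
  os_carrier : carrier L = carrier L1 `|` carrier L2;
  os_zero : zero_of L = zero_of L1;
  os_one : one_of L = one_of L2;
  os_ext1 : extends L1;
  os_ext2 : extends L2;
  os_le : forall x y, carrier L1 x -> carrier L2 y -> le L x y;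
  os_ge : forall x y, carrier L1 x -> carrier L2 y -> le L y x -> y = x;
  os_meet : forall x y, carrier L1 x -> carrier L2 y ->
    meet L x y = x /\ meet L y x = x;
  os_join : forall x y, carrier L1 x -> carrier L2 y ->
    join L x y = y /\ join L y x = y;
  os_mul : forall x y, carrier L1 x -> carrier L2 y ->
    mul L x y = x /\ mul L y x = x;
  os_imp_le : forall x y, carrier L x -> carrier L y -> le L x y ->
    imp L x y = one_of L;
  os_imp : forall x y, carrier L1 x -> carrier L2 y ->
    ~ carrier L2 x -> ~ le L y x -> imp L y x = x }.

Hypotheses (S : is_ordinal_sum) (r1 : residuated L1) (r2 : residuated L2).

Local Notation A1 := (carrier L1).
Local Notation A2 := (carrier L2).

Lemma os_in1 x : A1 x -> carrier L x.
Proof. by rewrite (os_carrier S); left. Qed.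

Lemma os_in2 x : A2 x -> carrier L x.
Proof. by rewrite (os_carrier S); right. Qed.

(** By [os_le] every inequality from [L1] up to [L2] holds, and by [os_ge] one
    from [L2] down to [L1] forces equality; so in each distribution of the
    arguments over the summands, a law either holds inside one summand or
    becomes trivial. *)
Lemma os_residuated : residuated L.
Proof.
have in1 := os_in1; have in2 := os_in2.
have LE := os_le S; have GE := os_ge S.
have [I1 I2] := (imp_closed r1, imp_closed r2).
have cases x : carrier L x -> A1 x \/ A2 x by rewrite (os_carrier S).
have [le1 le2] := (ext_le (os_ext1 S), ext_le (os_ext2 S)).
have [mt1 mt2] := (ext_meet (os_ext1 S), ext_meet (os_ext2 S)).
have [jn1 jn2] := (ext_join (os_ext1 S), ext_join (os_ext2 S)).
have [ml1 ml2] := (ext_mul (os_ext1 S), ext_mul (os_ext2 S)).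
have [im1 im2] := (ext_imp (os_ext1 S), ext_imp (os_ext2 S)).
have mt12 x y : A1 x -> A2 y -> meet L x y = x.
  by move=> Ax Ay; case: (os_meet S Ax Ay).
have mt21 x y : A1 x -> A2 y -> meet L y x = x.
  by move=> Ax Ay; case: (os_meet S Ax Ay).
have jn12 x y : A1 x -> A2 y -> join L x y = y.
  by move=> Ax Ay; case: (os_join S Ax Ay).
have jn21 x y : A1 x -> A2 y -> join L y x = y.
  by move=> Ax Ay; case: (os_join S Ax Ay).
have ml12 x y : A1 x -> A2 y -> mul L x y = x.
  by move=> Ax Ay; case: (os_mul S Ax Ay).
have ml21 x y : A1 x -> A2 y -> mul L y x = x.
  by move=> Ax Ay; case: (os_mul S Ax Ay).
have Mc1 := mul_closed r1; have Mc2 := mul_closed r2.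
have A1L : carrier L (one_of L).
  by rewrite (os_one S); apply: in2; apply: one_closed.
have lrefl x : carrier L x -> le L x x.
  by case/cases=> Ax; [apply/le1 | apply/le2] => //; apply: le_refl.
have ltrans y x z : carrier L x -> carrier L y -> carrier L z ->
    le L x y -> le L y z -> le L x z.
  case/cases=> Ax /cases[] Ay /cases[] Az xy yz; try exact: LE.
  - by apply/le1 => //; apply: (le_trans r1 (y := y)) => //; apply/le1.
  - by rewrite -(GE z y).
  - by rewrite (GE y x).
  - by rewrite (GE y x).
  - by rewrite -(GE z y).
  - by apply/le2 => //; apply: (le_trans r2 (y := y)) => //; apply/le2.
have lone x : carrier L x -> le L x (one_of L).
  rewrite (os_one S); have A12 := one_closed r2.
  by case/cases=> Ax; [apply: LE | apply/le2 => //; apply: le_one].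
have mulcl : closed_under L (mul L).
  move=> x y /cases[] Ax /cases[] Ay;
    [rewrite ml1|rewrite ml12|rewrite ml21|rewrite ml2] => //; auto.
have mcomm x y : carrier L x -> carrier L y -> mul L x y = mul L y x.
  move=> /cases[] Ax /cases[] Ay.
  - by rewrite !ml1 //; apply: mulC.
  - by rewrite ml12 ?ml21.
  - by rewrite ml21 ?ml12.
  - by rewrite !ml2 //; apply: mulC.
have mmono x y z : carrier L x -> carrier L y -> carrier L z ->
    le L x y -> le L (mul L x z) (mul L y z).
  move=> Lx Ly Lz xy.
  case: (cases _ Lx) => Ax; case: (cases _ Ly) => Ay; case: (cases _ Lz) => Az.
  - rewrite !ml1 //; apply/le1; auto.
    by apply: (mul_mono r1) => //; apply/le1.
  - by rewrite !ml12.
  - rewrite ml1 // ml21 //; apply/le1; auto.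
    exact: mul_ler.
  - by rewrite ml12 // ml2 //; apply: LE; auto.
  - by rewrite (GE y x Ay Ax xy); apply: lrefl; apply: mulcl.
  - by rewrite (GE y x Ay Ax xy); apply: lrefl; apply: mulcl.
  - by rewrite !ml21 //; apply: lrefl.
  - rewrite !ml2 //; apply/le2; auto.
    by apply: (mul_mono r2) => //; apply/le2.
have mulone x : carrier L x -> mul L x (one_of L) = x.
  rewrite (os_one S); have A12 := one_closed r2.
  by case/cases=> Ax; [apply: ml12 | rewrite ml2 // (mulx1 r2)].
have mullel x y : carrier L x -> carrier L y -> le L (mul L x y) x.
  move=> Lx Ly; rewrite mcomm // -[X in le L _ X]mulone //.
  rewrite [X in le L _ X]mcomm //; apply: mmono => //; exact: lone.
apply: Residuated => //.
- move=> x y /cases[] Ax /cases[] Ay xy yx.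
  + by apply: (le_anti r1) => //; apply/le1.
  + by rewrite (GE x y).
  + by rewrite (GE y x).
  + by apply: (le_anti r2) => //; apply/le2.
- move=> x y /cases[] Ax /cases[] Ay;
    [rewrite mt1|rewrite mt12|rewrite mt21|rewrite mt2] => //; auto.
  + by apply: in1; apply: meet_closed.
  + by apply: in2; apply: meet_closed.
- move=> x y /cases[] Ax /cases[] Ay;
    [rewrite mt1|rewrite mt12|rewrite mt21|rewrite mt2] => //; auto.
  + by apply/le1 => //; [apply: meet_closed | apply: meet_lel].
  + by apply/le2 => //; [apply: meet_closed | apply: meet_lel].
- move=> x y /cases[] Ax /cases[] Ay;
    [rewrite mt1|rewrite mt12|rewrite mt21|rewrite mt2] => //; auto.
  + by apply/le1 => //; [apply: meet_closed | apply: meet_ler].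
  + by apply/le2 => //; [apply: meet_closed | apply: meet_ler].
- move=> x y z /cases[] Ax /cases[] Ay Lz zx zy;
    [rewrite mt1|rewrite mt12|rewrite mt21|rewrite mt2] => //.
  + have Az : A1 z by case: (cases _ Lz) => // Az; rewrite (GE x z).
    apply/le1 => //; first exact: meet_closed.
    by apply: meet_glb => //; apply/le1.
  + case: (cases _ Lz) => Az; first by apply: LE => //; apply: meet_closed.
    apply/le2 => //; first exact: meet_closed.
    by apply: meet_glb => //; apply/le2.
- move=> x y /cases[] Ax /cases[] Ay;
    [rewrite jn1|rewrite jn12|rewrite jn21|rewrite jn2] => //; auto.
  + by apply: in1; apply: join_closed.
  + by apply: in2; apply: join_closed.
- move=> x y /cases[] Ax /cases[] Ay;
    [rewrite jn1|rewrite jn12|rewrite jn21|rewrite jn2] => //; auto.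
  + by apply/le1 => //; [apply: join_closed | apply: join_gel].
  + by apply/le2 => //; [apply: join_closed | apply: join_gel].
- move=> x y /cases[] Ax /cases[] Ay;
    [rewrite jn1|rewrite jn12|rewrite jn21|rewrite jn2] => //; auto.
  + by apply/le1 => //; [apply: join_closed | apply: join_ger].
  + by apply/le2 => //; [apply: join_closed | apply: join_ger].
- move=> x y z /cases[] Ax /cases[] Ay Lz xz yz;
    [rewrite jn1|rewrite jn12|rewrite jn21|rewrite jn2] => //.
  + case: (cases _ Lz) => Az; last by apply: LE => //; apply: join_closed.
    apply/le1 => //; first exact: join_closed.
    by apply: join_lub => //; apply/le1.
  + have Az : A2 z by case: (cases _ Lz) => // Az; rewrite -(GE z x).
    apply/le2 => //; first exact: join_closed.
    by apply: join_lub => //; apply/le2.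
- by rewrite (os_zero S); apply: in1; apply: zero_closed.
- rewrite (os_zero S) => x /cases[] Ax.
    by apply/le1 => //; [apply: zero_closed | apply: zero_le].
  by apply: LE => //; apply: zero_closed.
- move=> x y z /cases[] Ax /cases[] Ay /cases[] Az.
  + by rewrite !ml1 //; auto; apply: mulA.
  + by rewrite (ml12 y z) // (ml1 x y) // ml12; auto.
  + by rewrite (ml21 z y) // (ml12 x y).
  + by rewrite (ml2 y z) // (ml12 x y) // !ml12; auto.
  + by rewrite (ml1 y z) // (ml21 y x) // (ml1 y z) // ml21; auto.
  + by rewrite (ml12 y z) // (ml21 y x) // ml12.
  + by rewrite (ml21 z y) // (ml21 z x) // (ml2 x y) // ml21; auto.
  + by rewrite !ml2 //; auto; apply: mulA.
- move=> x y Lx Ly; have [xy|nxy] := pselect (le L x y).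
    by rewrite (os_imp_le S).
  case: (cases _ Lx) => Ax; case: (cases _ Ly) => Ay.
  + by rewrite im1 //; auto.
  + by case: nxy; apply: LE.
  + have [Ay2|nAy2] := pselect (A2 y); first by rewrite im2 //; auto.
    by rewrite (os_imp S).
  + by rewrite im2 //; auto.
move=> x y z Lx Ly Lz; have [xy|nxy] := pselect (le L x y).
  rewrite (os_imp_le S) //; split=> _; last exact: lone.
  by apply: (ltrans x); auto.
have high : A2 x -> A2 y -> le L z (imp L x y) <-> le L (mul L x z) y.
  move=> Ax Ay; rewrite im2 //; case: (cases _ Lz) => Az.
    by rewrite ml21 //; split=> _; apply: LE; auto.
  by rewrite ml2 // !le2; auto; apply: residuation.
case: (cases _ Lx) => Ax; case: (cases _ Ly) => Ay.
- rewrite im1 //.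
  (* For [z] in [L2] the product is [x], so that the right-hand side fails; and
     a [z] below [imp L1 x y] already lies in [L1]. *)
  have low : A1 z -> le L z (imp L1 x y) <-> le L (mul L x z) y.
    by move=> Az; rewrite ml1 // !le1; auto; apply: residuation.
  case: (cases _ Lz) => Az; first exact: low.
  split=> [zi|]; last by rewrite ml12.
  by apply/low => //; rewrite (GE _ _ _ Az zi); auto.
- by case: nxy; apply: LE.
- have [Ay2|nAy2] := pselect (A2 y); first exact: high.
  rewrite (os_imp S) //; case: (cases _ Lz) => Az; first by rewrite ml21.
  rewrite ml2 //; split=> h; case: nAy2.
  + by rewrite -(GE _ _ Ay Az h).
  + by rewrite -(GE _ _ Ay _ h); auto.
- exact: high.
Qed.

End OrdinalSums.

(** * Sums over a chain *)

Section ChainPlusBL.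
Variables (U : Type) (L L1 L2 : algebra U).
Hypothesis S : is_ordinal_sum L L1 L2.
Hypotheses (C1 : is_BL_chain L1) (B2 : is_BL_algebra L2).

Let B1 : is_BL_algebra L1 := C1.1.
Let r1 := BL_residuated B1.
Let r2 := BL_residuated B2.
Let rL := os_residuated S r1 r2.

(** Prelinearity can only be at stake for incomparable arguments; these both lie
    in [L2], where it holds, and the tops of [L2] and [L] coincide. *)
Lemma os_BL : is_BL_algebra L.
Proof.
have [[[_ _ dv1] [_ pl2 dv2]] tot] := (B1, B2, C1.2).
have cases x : carrier L x -> carrier L1 x \/ carrier L2 x.
  by rewrite (os_carrier S).
have E1 := os_ext1 S; have E2 := os_ext2 S.
split; first exact/residuatedP.
- move=> x y Lx Ly.
  have [|/not_orP[nxy nyx]] := pselect (le L x y \/ le L y x).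
    exact: prelinear_cmp.
  case: (cases _ Lx) => Ax; case: (cases _ Ly) => Ay.
  + by case: (tot _ _ Ax Ay); rewrite -(ext_le E1).
  + by case: nxy; apply: (os_le S).
  + by case: nyx; apply: (os_le S).
  + rewrite (ext_imp E2 Ax Ay nxy) (ext_imp E2 Ay Ax nyx).
    have [I2 I2'] := (imp_closed r2 Ax Ay, imp_closed r2 Ay Ax).
    by rewrite (ext_join E2) // pl2 // (os_one S).
- move=> x y Lx Ly; have [xy|nxy] := pselect (le L x y).
    by rewrite (imp_le rL) // (mulx1 rL) // (meet_l rL).
  case: (cases _ Lx) => Ax; case: (cases _ Ly) => Ay.
  + have I := imp_closed r1 Ax Ay.
    by rewrite (ext_imp E1) // (ext_mul E1) // (ext_meet E1) // dv1.
  + by case: nxy; apply: (os_le S).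
  + have [Ay2|nAy2] := pselect (carrier L2 y).
      have I := imp_closed r2 Ax Ay2.
      by rewrite (ext_imp E2) // (ext_mul E2) // (ext_meet E2) // dv2.
    rewrite (os_imp S) // (os_mul S Ay Ax).2.
    by rewrite (os_meet S Ay Ax).2.
  + have I := imp_closed r2 Ax Ay.
    by rewrite (ext_imp E2) // (ext_mul E2) // (ext_meet E2) // dv2.
Qed.

Lemma os_cut : one_of L1 = zero_of L2 -> is_cut L (one_of L1).
Proof.
move=> c0; have A1c := one_closed r1.
have A2c : carrier L2 (one_of L1) by rewrite c0; apply: zero_closed.
have cases x : carrier L x -> carrier L1 x \/ carrier L2 x.
  by rewrite (os_carrier S).
have [E1 E2] := (os_ext1 S, os_ext2 S).
split; first exact: (os_in1 S).
- by rewrite (ext_mul E1) // (mulx1 r1).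
- move=> x /cases[] Ax; [left|right]; last exact: (os_le S).
  by apply/(ext_le E1) => //; apply: le_one.
- have low x : carrier L x -> le L x (one_of L1) -> carrier L1 x.
    by move=> /cases[]// Ax xc; rewrite (os_ge S A1c Ax xc).
  move=> x y [Lx xc] [Ly yc]; have [Ax Ay] := (low _ Lx xc, low _ Ly yc).
  by rewrite !(ext_le E1) //; apply: C1.2.
Qed.

End ChainPlusBL.

(** * The binary sum *)

Section BinarySum.
Variables (U : Type) (L1 L2 : algebra U).
Hypotheses (r1 : residuated L1) (r2 : residuated L2) (G : glueable L1 L2).

Local Notation A1 := (carrier L1).
Local Notation A2 := (carrier L2).
Local Notation c := (one_of L1).

Lemma glueable_cap x : A1 x -> A2 x -> x = c.
Proof.
case: G => c0 dis Ax1 Ax2; apply: contrapT => nx.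
suff : set0 x by [].
by rewrite -dis; split; split=> //; rewrite /= -c0.
Qed.

Lemma glue_in2 : A2 c.
Proof. by rewrite G.1; apply: zero_closed. Qed.

Lemma osum_ext1 : extends (osum L1 L2) L1.
Proof.
have c2 := glue_in2; have c1 := one_closed r1.
move=> x y Ax Ay; have [mx my] : x \in A1 /\ y \in A1 by rewrite !inE.
rewrite /= mx my /=; split=> //; last by move/asboolPn/negbTE => ->.
split=> [[[]//|[Ax2 Ay2 _]|[_ Ay2]]|xy]; last by apply: Or31.
  by rewrite (glueable_cap Ax Ax2) (glueable_cap Ay Ay2); apply: le_refl.
by rewrite (glueable_cap Ay Ay2); apply: le_one.
Qed.

Lemma osum_ext2 : extends (osum L1 L2) L2.
Proof.
have c2 := glue_in2; have c1 := one_closed r1; have c0 := G.1.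
move=> x y Ax Ay; have [mx my] : x \in A2 /\ y \in A2 by rewrite !inE.
have cap : (x \in A1) && (y \in A1) -> x = c /\ y = c.
  by move=> /andP[]; rewrite !inE => ? ?; split; apply: glueable_cap.
rewrite /= mx my /=; split.
- split=> [[[Ax1 Ay1 _]|[]//|[Ax1 _]]|xy]; last by apply: Or32.
    by rewrite (glueable_cap Ax1 Ax) (glueable_cap Ay1 Ay); apply: le_refl.
  by rewrite (glueable_cap Ax1 Ax) c0; apply: zero_le.
- case: ifP => // /cap[-> ->].
  by rewrite !meet_l //; apply: le_refl.
- case: ifP => // /cap[-> ->].
  by rewrite !join_l //; apply: le_refl.
- case: ifP => // /cap[-> ->].
  by rewrite (mulx1 r1) // c0 mulx0 // -c0.
- move=> nxy; move/asboolPn/negbTE: (nxy) => ->.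
  case: ifP => // /cap[xc yc]; case: nxy; rewrite xc yc.
  by apply: Or31; split=> //; apply: le_refl.
Qed.

(** The two summands meet only in the gluing point [c], at which the rules of
    either summand and the rules for mixed arguments agree. *)
Lemma osum_ordinal_sum : is_ordinal_sum (osum L1 L2) L1 L2.
Proof.
have c2 := glue_in2; have c1 := one_closed r1; have c0 := G.1.
have ge x y : A1 x -> A2 y -> osum_le L1 L2 y x -> y = x.
  move=> Ax Ay [[Ay1 _ yx]|[_ Ax2 yx]|[Ay1 Ax2]].
  - move: yx; rewrite (glueable_cap Ay1 Ay) => yx.
    by apply: (le_anti r1) => //; apply: le_one.
  - move: yx; rewrite (glueable_cap Ax Ax2) c0 => yx.
    by apply: (le_anti r2) => //; [rewrite -c0|apply: zero_le].
  - by rewrite (glueable_cap Ay1 Ay) (glueable_cap Ax Ax2).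
split=> //.
- exact: osum_ext1.
- exact: osum_ext2.
- by move=> x y Ax Ay; apply: Or33.
- move=> x y Ax Ay; rewrite /= !(mem_set Ax) !(mem_set Ay) !andbT /=.
  have [Ay1|nAy1] := pselect (A1 y); last rewrite (memNset nAy1).
    rewrite (mem_set Ay1) (glueable_cap Ay1 Ay).
    by rewrite meet_l ?meet_r //; apply: le_one.
  have [Ax2|nAx2] := pselect (A2 x); last by rewrite (memNset nAx2).
  rewrite (mem_set Ax2) (glueable_cap Ax Ax2).
  by rewrite meet_l ?meet_r // c0; apply: zero_le.
- move=> x y Ax Ay; rewrite /= !(mem_set Ax) !(mem_set Ay) !andbT /=.
  have [Ay1|nAy1] := pselect (A1 y); last rewrite (memNset nAy1).
    rewrite (mem_set Ay1) (glueable_cap Ay1 Ay).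
    by rewrite join_r ?join_l //; apply: le_one.
  have [Ax2|nAx2] := pselect (A2 x); last by rewrite (memNset nAx2).
  rewrite (mem_set Ax2) (glueable_cap Ax Ax2).
  by rewrite join_r ?join_l // c0; apply: zero_le.
- move=> x y Ax Ay; rewrite /= !(mem_set Ax) !(mem_set Ay) !andbT /=.
  have [Ay1|nAy1] := pselect (A1 y); last rewrite (memNset nAy1).
    by rewrite (mem_set Ay1) (glueable_cap Ay1 Ay) (mulx1 r1) ?(mul1x r1).
  have [Ax2|nAx2] := pselect (A2 x); last by rewrite (memNset nAx2).
  by rewrite (mem_set Ax2) (glueable_cap Ax Ax2) c0 (mul0x r2) ?(mulx0 r2).
- by move=> x y _ _ xy; rewrite /= asboolT.
- move=> x y Ax Ay nAx2 nyx; rewrite /= asboolF // (memNset nAx2) andbF.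
  case: ifP => // /andP[]; rewrite inE => Ay1 _.
  by rewrite (glueable_cap Ay1 Ay) imp1x.
Qed.

(** Two incomparable elements of [L1] violate prelinearity: the join of their
    two implications is computed in [L1], hence lies below [c], which is no
    longer the top. *)
Lemma osum_not_BL : nontrivial L2 -> ~ is_chain L1 ->
  ~ is_BL_algebra (osum L1 L2).
Proof.
move=> nt2 nch [_ pl _]; apply: nch => x y Ax Ay.
have E1 := osum_ext1.
have [//|/not_orP[nxy nyx]] := pselect (le L1 x y \/ le L1 y x).
have [I I'] := (imp_closed r1 Ax Ay, imp_closed r1 Ay Ax).
case: nt2; rewrite -G.1; apply/esym/glueable_cap; last exact: one_closed.
have -> : one_of L2 = one_of (osum L1 L2) by [].
rewrite -(pl x y); [|by left..].
rewrite (ext_imp E1) // ?(ext_le E1) // (ext_imp E1) // ?(ext_le E1) //.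
by rewrite (ext_join E1) //; apply: join_closed.
Qed.

End BinarySum.

(** * Components of an n-ary sum *)

(** The one-point algebra is neutral for ordinal sums, which lets a sum with a
    single component be treated as a binary ordinal sum. *)
Definition point (U : Type) (z : U) : algebra U := {|
  carrier := [set z]; le := fun _ _ => True;
  meet := fun x _ => x; join := fun x _ => x; mul := fun x _ => x;
  imp := fun x _ => x; zero_of := z; one_of := z |}.

Lemma point_BL_chain (U : Type) (z : U) : is_BL_chain (point z).
Proof.
split; last by left.
split=> [|x y -> ->//|x y -> ->//]; apply/residuatedP.
by split=> //= x y -> ->.
Qed.

Section Components.
Variables (U : Type) (n : nat) (C : 'I_n.+1 -> algebra U).
Hypotheses (rC : forall i, residuated (C i)) (G : glueable_family C).

(** Components that are not adjacent can share a point: the components between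
    them then contain that point too, and so are trivial.  Indeed
    [glueable_family] makes a shared point [x] the top of [C i] or the bottom of
    [C j]; hence [x] lies in [C i.+1] or in [C j.-1], which may replace
    [C i] or [C j]. *)
Lemma overlap (i j : 'I_n.+1) x : (i < j)%N ->
  carrier (C i) x -> carrier (C j) x ->
  [/\ x = one_of (C i), x = zero_of (C j)
    & forall m : 'I_n.+1, (i < m < j)%N -> carrier (C m) x].
Proof.
have ends (a b : 'I_n.+1) : (a < b)%N -> carrier (C a) x -> carrier (C b) x ->
    x = one_of (C a) \/ x = zero_of (C b).
  move=> ab Ca Cb; apply: contrapT => /not_orP[x1 x0]; suff : set0 x by [].
  by rewrite -(G.2 a b ab).
move=> ij; have [k jE] : exists k, j = i + k.+1 :> nat.
  by exists (j - i).-1; rewrite prednK ?subn_gt0 // subnKC // ltnW.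
elim: k i j ij jE => [|k IH] i j ij jE Ci Cj.
  have c : one_of (C i) = zero_of (C j) by apply: G.1; rewrite jE addn1.
  split=> [||m]; last by rewrite jE addn1 ltnS ltnNge; case: leqP.
    by case: (ends _ _ ij Ci Cj) => // ->.
  by case: (ends _ _ ij Ci Cj) => // ->.
have [x1|x0] := ends _ _ ij Ci Cj.
- have lt : (i.+1 < n.+1)%N by apply: leq_ltn_trans ij (ltn_ord j).
  pose i' := Ordinal lt; have c : one_of (C i) = zero_of (C i') by apply: G.1.
  have Ci' : carrier (C i') x by rewrite x1 c; apply: zero_closed.
  have i'j : (i' < j)%N by rewrite jE /= !addnS !ltnS leq_addr.
  have [|_ x0 mid] := IH i' j i'j _ Ci' Cj; first by rewrite jE /= addSnnS.
  split=> // m /andP[]; rewrite leq_eqVlt => /orP[/eqP im _|im mj].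
    by have -> : m = i' by apply: val_inj.
  by apply: mid; rewrite /= im.
- have lt : (i + k.+1 < n.+1)%N.
    by apply: ltn_trans (ltn_ord j); rewrite jE ltn_add2l.
  pose j' := Ordinal lt; have jE' : j = j'.+1 :> nat by rewrite jE addnS.
  have c : one_of (C j') = zero_of (C j) by apply: G.1.
  have Cj' : carrier (C j') x by rewrite x0 -c; apply: one_closed.
  have ij' : (i < j')%N by rewrite /= addnS ltnS leq_addr.
  have [//|x1 _ mid] := IH i j' ij' _ Ci Cj'.
  split=> // m /andP[im]; rewrite jE' ltnS leq_eqVlt => /orP[/eqP mj|mj].
    by have -> : m = j' by apply: val_inj.
  by apply: mid; rewrite im.
Qed.

Lemma overlap_eq i j x y : i <> j -> carrier (C i) x -> carrier (C i) y ->
  carrier (C j) x -> carrier (C j) y -> x = y.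
Proof.
move=> /eqP; rewrite neq_ltn => /orP[] ij Cix Ciy Cjx Cjy.
  by have [-> _ _] := overlap ij Cix Cjx; have [-> _ _] := overlap ij Ciy Cjy.
by have [-> _ _] := overlap ij Cjx Cix; have [-> _ _] := overlap ij Cjy Ciy.
Qed.

Lemma overlap_idem i j x : i <> j -> carrier (C i) x -> carrier (C j) x ->
  mul (C i) x x = x.
Proof.
move=> /eqP; rewrite neq_ltn => /orP[] ij Cix Cjx.
  by have [e _ _] := overlap ij Cix Cjx; rewrite [X in mul _ _ X]e mulx1.
by have [_ e _] := overlap ij Cjx Cix; rewrite [X in mul _ _ X]e mulx0.
Qed.

(** If the component picked by [common] is not [C i], then [x] and [y] are the
    same shared point, and every operation except [imp] leaves it fixed. *)
Lemma nsum_ext i : extends (nsum C) (C i).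
Proof.
move=> x y Cx Cy.
have leP : le (nsum C) x y <-> le (C i) x y.
  split=> [[[k [Kx Ky kxy]]|[k [l [kl Kx Ly]]]]|xy]; last by left; exists i.
    have [ki|/overlap_eq xy] := pselect (k = i); first by rewrite -ki.
    by rewrite (xy x y) //; apply: le_refl.
  case: (ltngtP k i) => [ki|ik|/val_inj ki].
  - by have [_ -> _] := overlap ki Kx Cx; apply: zero_le.
  - by have [-> _ _] := overlap (ltn_trans ik kl) Cy Ly; apply: le_one.
  - move: kl; rewrite ki => il.
    by have [-> _ _] := overlap il Cy Ly; apply: le_one.
rewrite /= /common; case: pickP => [k /andP[]|/(_ i)]; last by rewrite !mem_set.
rewrite !inE => Kx Ky; have [ki|nki] := pselect (k = i).
  by rewrite ki; split=> //= /asboolPn/negbTE ->.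
have xy := overlap_eq nki Kx Ky Cx Cy; rewrite -{}xy in Cy Ky leP *.
have [ri rk] := (le_refl (rC i) Cx, le_refl (rC k) Kx).
split=> //.
- by rewrite !meet_l.
- by rewrite !join_l.
- by rewrite (overlap_idem nki) // (@overlap_idem i k) // => /esym.
- by case/leP.
Qed.

Lemma nsum_apart x y : (forall i, carrier (C i) x -> ~ carrier (C i) y) ->
  [/\ meet (nsum C) x y = if `[< nsum_le C x y >] then x else y,
      join (nsum C) x y = if `[< nsum_le C x y >] then y else x,
      mul (nsum C) x y = if `[< nsum_le C x y >] then x else y
    & ~ nsum_le C x y -> imp (nsum C) x y = y].
Proof.
move=> apart; rewrite /= /common; case: pickP => [i /andP[]|_].
  by rewrite !inE => Cx Cy; case: (apart i).
by split=> //= /asboolPn/negbTE ->.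
Qed.

Lemma nsum_in i x : carrier (C i) x -> carrier (nsum C) x.
Proof. by exists i. Qed.

Lemma nsum_imp_le x y : le (nsum C) x y -> imp (nsum C) x y = one_of (nsum C).
Proof. by move=> xy; rewrite /= asboolT. Qed.

End Components.

(** * Splitting off the lowest component *)

Section Tail.
Variables (U : Type) (n : nat) (C : 'I_n.+2 -> algebra U).
Hypotheses (rC : forall i, residuated (C i)) (G : glueable_family C).

Local Notation tail := (fun i : 'I_n.+1 => C (lift ord0 i)).
Local Notation c := (one_of (C ord0)).

Lemma tail_glueable : glueable_family tail.
Proof.
split=> i j ij; first by apply: G.1; rewrite !lift0 ij.
by apply: G.2; rewrite !lift0.
Qed.

Let rT i : residuated (tail i) := rC (lift ord0 i).

Lemma ord0P (i : 'I_n.+2) : i = ord0 \/ exists k, i = lift ord0 k.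
Proof. by case: (unliftP ord0 i) => [k|] ->; [right; exists k | left]. Qed.

Lemma tail_cap x : carrier (C ord0) x -> carrier (nsum tail) x ->
  x = c /\ carrier (tail ord0) x.
Proof.
move=> C0 [k _ Ck]; have [//|-> _ _] := overlap rC G _ C0 Ck.
split=> //; rewrite (G.1 _ (lift ord0 ord0)) //.
exact: zero_closed.
Qed.

Lemma tail_le x y : carrier (nsum tail) x -> carrier (nsum tail) y ->
  le (nsum C) x y <-> le (nsum tail) x y.
Proof.
move=> Tx Ty; split; last first.
  case=> [[k [Kx Ky xy]]|[k [l [kl Kx Ly]]]].
    by left; exists (lift ord0 k).
  by right; exists (lift ord0 k), (lift ord0 l); rewrite !lift0.
case=> [[k]|[k [l]]].
  case: (ord0P k) => [->|[k' ->]] [Kx Ky xy]; last by left; exists k'.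
  have [xc T0x] := tail_cap Kx Tx; have [yc _] := tail_cap Ky Ty.
  by left; exists ord0; rewrite yc -xc; split=> //; apply: (le_refl (rT _)).
case: (ord0P l) => [->|[l' ->]] [kl Kx Ly]; first by case: k kl {Kx}.
move: kl Kx; case: (ord0P k) => [->|[k' ->]] kl Kx; last first.
  by right; exists k', l'.
have [xc T0x] := tail_cap Kx Tx.
have [l0|l0] := posnP l'; last by right; exists ord0, l'.
left; exists ord0; have <- : l' = ord0 by apply: val_inj.
rewrite xc (G.1 _ (lift ord0 l')); last by rewrite lift0 l0.
by split=> //; [apply: zero_closed | apply: (zero_le (rT _))].
Qed.

Lemma tail_ext : extends (nsum C) (nsum tail).
Proof.
move=> x y Tx Ty; have leP := tail_le Tx Ty.
have [[k [Kx Ky]]|/forallNP apart] :=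
    pselect (exists k, carrier (tail k) x /\ carrier (tail k) y).
  have E := nsum_ext rC G (i := lift ord0 k).
  have E' := nsum_ext rT tail_glueable (i := k).
  split=> //.
  - by rewrite (ext_meet E) ?(ext_meet E').
  - by rewrite (ext_join E) ?(ext_join E').
  - by rewrite (ext_mul E) ?(ext_mul E').
  - move=> nxy; rewrite (ext_imp E) ?(ext_imp E') //.
    by rewrite -leP.
have apartT k : carrier (tail k) x -> ~ carrier (tail k) y.
  by move=> Kx Ky; apply: (apart k).
have apartC i : carrier (C i) x -> ~ carrier (C i) y.
  case: (ord0P i) => [->|[k ->]]; last exact: apartT.
  move=> Cx Cy; have [_ Tx0] := tail_cap Cx Tx; have [_ Ty0] := tail_cap Cy Ty.
  exact: (apartT ord0).
have [-> -> -> I] := nsum_apart apartC; have [-> -> -> I'] := nsum_apart apartT.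
have -> : `[< nsum_le C x y >] = `[< nsum_le tail x y >].
  exact: asbool_equiv_eq.
by split=> // nxy; rewrite I // I' // => /leP.
Qed.

Lemma nsum_ordinal_sum : is_ordinal_sum (nsum C) (C ord0) (nsum tail).
Proof.
have c0 : c = zero_of (tail ord0) by apply: G.1.
have E := nsum_ext rC G.
have LE x y : carrier (C ord0) x -> carrier (nsum tail) y -> le (nsum C) x y.
  by move=> Cx [k _ Ky]; right; exists ord0, (lift ord0 k).
have GE x y : carrier (C ord0) x -> carrier (nsum tail) y ->
    le (nsum C) y x -> y = x.
  move=> Cx Ty [[i]|[i [j [ij Iy Jx]]]].
    case: (ord0P i) => [->|[k ->]] [Ky Kx yx].
      rewrite (tail_cap Ky Ty).1 in yx *.
      by apply: (le_anti (rC ord0)) => //; [apply: one_closed | apply: le_one].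
    have [//|_ x0 _] := overlap rC G _ Cx Kx.
    apply: (le_anti (rC (lift ord0 k))) => //.
    by rewrite x0; apply: zero_le.
  have j0 : (0 < j)%N by apply: leq_ltn_trans ij.
  have [x1 _ mid] := overlap rC G (i := ord0) j0 Cx Jx.
  have [i0|i0] := posnP i.
    have ei : i = ord0 by apply: val_inj.
    by rewrite ei in Iy; rewrite x1 (tail_cap Iy Ty).1.
  (* [x] is now both the bottom and the top of [C i], which contains [y]. *)
  have Ix : carrier (C i) x by apply: mid; rewrite /= i0 ij.
  have [_ x0 _] := overlap rC G (i := ord0) i0 Cx Ix.
  have [x1' _ _] := overlap rC G ij Ix Jx.
  apply: (le_anti (rC i)) => //.
    by rewrite x1'; apply: le_one.
  by rewrite x0; apply: zero_le.
have apart x y : (forall i, carrier (C i) x -> ~ carrier (C i) y) ->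
    forall i, carrier (C i) y -> ~ carrier (C i) x.
  by move=> a i Cy Cx; apply: (a i).
have mixed x y : carrier (C ord0) x -> carrier (nsum tail) y ->
  [/\ meet (nsum C) x y = x /\ meet (nsum C) y x = x,
      join (nsum C) x y = y /\ join (nsum C) y x = y,
      mul (nsum C) x y = x /\ mul (nsum C) y x = x
    & ~ carrier (nsum tail) x -> ~ le (nsum C) y x -> imp (nsum C) y x = x].
  move=> Cx Ty; have xy := LE x y Cx Ty; have yx := GE x y Cx Ty.
  have [[k [Kx Ky]]|/forallNP napart] :=
      pselect (exists k, carrier (C k) x /\ carrier (C k) y).
    have kxy : le (C k) x y by apply/(ext_le (E k)).
    have xmul : mul (C k) x y = x.
      case: (ord0P k) => [k0|[l kl]].
        by rewrite k0 in Ky *; rewrite (tail_cap Ky Ty).1 mulx1.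
      rewrite kl in Kx Ky *.
      have [//|_ -> _] := overlap rC G _ Cx Kx.
      by rewrite mul0x.
    split=> [|||nTx nyx].
    - by rewrite !(ext_meet (E k)) // meet_l ?meet_r.
    - by rewrite !(ext_join (E k)) // join_r ?join_l.
    - by rewrite !(ext_mul (E k)) // (mulC (rC k) Ky Kx).
    - rewrite (ext_imp (E k)) //; case: (ord0P k) => [k0|[l kl]].
        by rewrite k0 in Ky *; rewrite (tail_cap Ky Ty).1 imp1x.
      by case: nTx; exists l; rewrite // -kl.
  have a1 i : carrier (C i) x -> ~ carrier (C i) y.
    by move=> Kx Ky; apply: (napart i).
  have [-> -> -> _] := nsum_apart a1.
  have [-> -> -> I] := nsum_apart (apart _ _ a1).
  rewrite (asboolT xy).
  by split=> //; split=> //; case: ifP => // /asboolP/yx ->.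
split=> //.
- apply/seteqP; split=> x; last first.
    by case=> [Cx|[k _ Kx]]; [exists ord0 | exists (lift ord0 k)].
  case=> i _; case: (ord0P i) => [->|[k ->]] Cx; first by left.
  by right; exists k.
- by rewrite /=; congr (one_of (C _)); apply: val_inj.
- exact: tail_ext.
- by move=> x y Cx Ty; case: (mixed x y Cx Ty).
- by move=> x y Cx Ty; case: (mixed x y Cx Ty).
- by move=> x y Cx Ty; case: (mixed x y Cx Ty).
- by move=> x y _ _; apply: nsum_imp_le.
- by move=> x y Cx Ty; case: (mixed x y Cx Ty).
Qed.

End Tail.

(** * The n-ary sum of chains and a BL-algebra *)

Section NarySum.
Variable U : Type.

Lemma nsum1_ordinal_sum (C : 'I_1 -> algebra U) :
  residuated (C ord0) -> glueable_family C ->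
  is_ordinal_sum (nsum C) (point (zero_of (C ord0))) (C ord0).
Proof.
move=> r0 G; have rC i : residuated (C i) by rewrite ord1.
have E := nsum_ext rC G (i := ord0); have z := zero_closed r0.
have zz := le_refl r0 z.
split=> //.
- apply/seteqP; split=> x; last by case=> [->|Cx]; exists ord0.
  by case=> i _; rewrite ord1; right.
- by rewrite /= (ord1 ord_max).
- move=> x y -> ->; have zzL := (ext_le E z z).2 zz; split=> //.
  + by rewrite (ext_meet E) // meet_l.
  + by rewrite (ext_join E) // join_l.
  + by rewrite (ext_mul E) // mulx0.
- by move=> x y -> Cy; apply/(ext_le E) => //; apply: zero_le.
- move=> x y -> Cy /(ext_le E) yz; apply: (le_anti r0) => //; first exact: yz.
  exact: zero_le.
- move=> x y -> Cy; have zy := zero_le r0 Cy.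
  by rewrite !(ext_meet E) // meet_l // meet_r.
- move=> x y -> Cy; have zy := zero_le r0 Cy.
  by rewrite !(ext_join E) // join_r // join_l.
- by move=> x y -> Cy; rewrite !(ext_mul E) // mulx0 // mul0x.
- by move=> x y _ _; apply: nsum_imp_le.
- by move=> x y ->.
Qed.

Section Family.
Variables (n : nat) (C : 'I_n.+1 -> algebra U).
Hypothesis chainC : forall i : 'I_n.+1, (i < n)%N -> is_BL_chain (C i).
Hypothesis lastC : is_BL_algebra (C ord_max).

Lemma family_BL i : is_BL_algebra (C i).
Proof.
have [im|im] := eqVneq i ord_max; first by rewrite im.
have [] // := chainC (i := i); rewrite ltn_neqAle -ltnS ltn_ord andbT.
by apply: contraNneq im => im; apply/eqP/val_inj.
Qed.

End Family.

Lemma nsum_BL n (C : 'I_n.+1 -> algebra U) :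
  (forall i : 'I_n.+1, (i < n)%N -> is_BL_chain (C i)) ->
  is_BL_algebra (C ord_max) -> glueable_family C -> is_BL_algebra (nsum C).
Proof.
elim: n C => [|n IH] C chainC lastC G.
  have B0 : is_BL_algebra (C ord0) by rewrite ord1 in lastC.
  have S := nsum1_ordinal_sum (BL_residuated B0) G.
  exact: os_BL S (point_BL_chain _) B0.
have rC i := BL_residuated (family_BL chainC lastC i).
apply: (os_BL (nsum_ordinal_sum rC G)); first exact: chainC.
apply: IH.
- by move=> i lt; apply: chainC; rewrite lift0.
- by have -> : lift ord0 ord_max = ord_max :> 'I_n.+2 by apply: val_inj.
- exact: tail_glueable.
Qed.

Section GluingPoint.
Variables (n : nat) (C : 'I_n.+1 -> algebra U).
Hypothesis chainC : forall i : 'I_n.+1, (i < n)%N -> is_BL_chain (C i).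
Hypotheses (lastC : is_BL_algebra (C ord_max)) (G : glueable_family C).
Variables (i j : 'I_n.+1).
Hypothesis ij : (i < j)%N.

Let rC k : residuated (C k) := BL_residuated (family_BL chainC lastC k).
Let rL : residuated (nsum C) := BL_residuated (nsum_BL chainC lastC G).
Let E k : extends (nsum C) (C k) := nsum_ext rC G (i := k).

Local Notation e := (one_of (C i)).

Lemma nsum_cut : is_cut (nsum C) e.
Proof.
have Ce := one_closed (rC i); have Le := nsum_in Ce.
have above (k : 'I_n.+1) x : (i < k)%N -> carrier (C k) x -> le (nsum C) e x.
  by move=> ik Cx; right; exists i, k.
split=> //.
- by rewrite (ext_mul (@E i)) // mulx1.
- move=> x [k _ Cx]; case: (ltngtP k i) => [ki|ik|/val_inj ki].
  + by left; right; exists k, i.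
  + by right; apply: above ik Cx.
  + rewrite ki in Cx.
    by left; apply/(ext_le (@E i)) => //; apply: le_one.
- move=> x y [[k _ Cx] xe] [[l _ Cy] ye].
  have [Lx Ly] := (nsum_in Cx, nsum_in Cy).
  have [ik|ki] := ltnP i k.
    by right; rewrite (le_anti rL Lx Le xe (above _ _ ik Cx)).
  have [il|li] := ltnP i l.
    by left; rewrite (le_anti rL Ly Le ye (above _ _ il Cy)).
  case: (ltngtP k l) => [kl|lk|/val_inj kl].
  + by left; right; exists k, l.
  + by right; right; exists l, k.
  + rewrite kl in Cx; rewrite !(ext_le (@E l)) //; apply: (chainC _).2 => //.
    by apply: leq_ltn_trans li (leq_trans ij _); rewrite -ltnS.
Qed.

Lemma nsum_cut_neq0 : nontrivial (C i) -> e <> zero_of (nsum C).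
Proof.
move=> nt e0; apply: nt.
have [Cz Ce] := (zero_closed (rC i), one_closed (rC i)).
apply: (le_anti (rC i)) => //; first exact: zero_le.
apply/(ext_le (@E i)) => //; rewrite e0.
by apply: (zero_le rL); apply: nsum_in Cz.
Qed.

(** All of [C j] lies between [e] and the top, so [C j] is trivial if these
    coincide. *)
Lemma nsum_cut_neq1 : nontrivial (C j) -> e <> one_of (nsum C).
Proof.
move=> nt e1; apply: nt.
have [[Cz Co] Ce] := (zero_closed (rC j), one_closed (rC j), one_closed (rC i)).
have [[Lz Lo] Le] := (nsum_in Cz, nsum_in Co, nsum_in Ce).
apply: (le_anti (rC j)) => //; first exact: zero_le.
apply/(ext_le (@E j)) => //; apply: (le_trans rL (y := e)) => //.
  by rewrite e1; apply: (le_one rL).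
by right; exists i, j.
Qed.

End GluingPoint.
End NarySum.

Theorem mainTheorem4 (U : Type) :
  (* (1) *)
  (forall L1 L2 : algebra U,
     is_BL_algebra L1 -> is_BL_algebra L2 -> glueable L1 L2 ->
     is_residuated_lattice (osum L1 L2) /\
     (nontrivial L2 -> ~ is_chain L1 -> ~ is_BL_algebra (osum L1 L2)))
  /\
  (* (2) *)
  (forall L1 L2 : algebra U,
     is_BL_chain L1 -> is_BL_algebra L2 -> glueable L1 L2 ->
     [/\ is_BL_algebra (osum L1 L2),
         nontrivial L1 ->
           [/\ exists x, nodes (osum L1 L2) x /\ x <> zero_of (osum L1 L2),
               forall m, is_max (osum L1 L2) (nodes (osum L1 L2)) m ->
                 m <> zero_of (osum L1 L2)
             & finite_set (carrier (osum L1 L2)) ->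
               exists m, is_max (osum L1 L2) (nodes (osum L1 L2)) m /\
                 m <> zero_of (osum L1 L2)]
       & nontrivial L1 -> nontrivial L2 -> ~ is_MV_algebra (osum L1 L2)])
  /\
  (* (3) *)
  (forall (n : nat) (C : 'I_n.+1 -> algebra U),
     (forall i : 'I_n.+1, (i < n)%N -> is_BL_chain (C i)) ->
     is_BL_algebra (C ord_max) ->
     glueable_family C ->
     (forall i : 'I_n.+1, finite_set (carrier (C i))) ->
     (exists i j : 'I_n.+1, [/\ (i < j)%N, nontrivial (C i) & nontrivial (C j)]) ->
     is_BL_comet (nsum C) /\ ~ is_MV_algebra (nsum C)).
Proof.
split; [|split].
- move=> L1 L2 B1 B2 G; have [r1 r2] := (BL_residuated B1, BL_residuated B2).
  split; last exact: osum_not_BL.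
  by apply/residuatedP; apply: (os_residuated (osum_ordinal_sum r1 r2 G)).
- move=> L1 L2 C1 B2 G; have [r1 r2] := (BL_residuated C1.1, BL_residuated B2).
  have S := osum_ordinal_sum r1 r2 G.
  have B := os_BL S C1 B2; have cut := os_cut S C1 B2 G.1.
  have neq0 : nontrivial L1 -> one_of L1 <> zero_of L1 by move=> nt /esym.
  split=> // [/neq0 c0|/neq0 c0 nt2].
    split; first by exists (one_of L1); split=> //; apply: cut_node.
    + by move=> m; apply: (cut_max_neq0 B cut c0).
    + exact: (cut_max B cut c0).
  by apply: (cut_not_MV B cut c0) => c1; apply: nt2; rewrite -G.1.
- move=> n C chainC lastC G finC [i [j [ij nti ntj]]].
  have B := nsum_BL chainC lastC G.
  have cut := nsum_cut chainC lastC G ij.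
  have e0 := nsum_cut_neq0 chainC lastC G nti.
  have finL : finite_set (carrier (nsum C)).
    by apply: bigcup_finite => [|k _]; [apply: finite_finset | apply: finC].
  split; first by split=> //; apply: (cut_max B cut e0 finL).
  exact: (cut_not_MV B cut e0 (nsum_cut_neq1 chainC lastC G ij ntj)).
Qed.
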